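(* (a) Let $\mathcal Z\subseteq\mathbb R^n$ be nonempty, closed, bounded and convex, let $F:\mathbb R^n\to\mathbb R$ be $\ell$-smooth with $\ell>0$, and let $\epsilon>0$. If $\bar{\mathbf z}\in\mathcal Z$ is an $\epsilon$-stationary point of the second type of $\min_{\mathbf z\in\mathcal Z}F(\mathbf z)$, then $\bar{\mathbf z}$ is an $\epsilon$-stationary point of the first type of that problem. (b) For every $\epsilon>0$ there exist an optimization problem $\min_{\mathbf z\in\mathcal Z}F(\mathbf z)$ of this form and a feasible point $\bar{\mathbf z}\in\mathcal Z$ such that $\bar{\mathbf z}$ is an $\epsilon$-stationary point of the first type but is not an $\epsilon'$-stationary point of the second type for any $0\le\epsilon'<\sqrt{2\epsilon+\epsilon^2}$.
   Context: $F$ is $\ell$-smooth if it is differentiable and $\|\nabla F(\mathbf z_1)-\nabla F(\mathbf z_2)\|\le\ell\|\mathbf z_1-\mathbf z_2\|$ for all $\mathbf z_1,\mathbf z_2$ (Euclidean norm). $\mathcal P_{\mathcal Z}$ denotes Euclidean projection onto $\mathcal Z$. A point $\bar{\mathbf z}\in\mathcal Z$ is an $\epsilon$-stationary point of the first type of $\min_{\mathbf z\in\mathcal Z}F(\mathbf z)$ if $\big\|\mathcal P_{\mathcal Z}\big(\bar{\mathbf z}-\frac1\ell\nabla F(\bar{\mathbf z})\big)-\bar{\mathbf z}\big\|\le\frac\epsilon\ell$. It is an $\epsilon$-stationary point of the second type if $D(\bar{\mathbf z})\le\epsilon^2$, where $D(\bar{\mathbf z})=-2\ell\min_{\mathbf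 z\in\mathcal Z}\big[\langle\nabla F(\bar{\mathbf z}),\mathbf z-\bar{\mathbf z}\rangle+\frac\ell2\|\mathbf z-\bar{\mathbf z}\|^2\big]$. *)

(* Defs.v *)
(* MathComp-Analysis; the reals are an arbitrary [R : realType]. *)
From HB Require Import structures.
From mathcomp Require Import all_boot all_order all_algebra.
From mathcomp Require Import all_classical all_reals all_analysis.

Set Implicit Arguments.
Unset Strict Implicit.
Unset Printing Implicit Defensive.

Import Order.TTheory GRing.Theory Num.Theory numFieldNormedType.Exports.
Local Open Scope classical_set_scope.
Local Open Scope ring_scope.

Section Stationarity.
Context {R : realType} {n : nat}.
Implicit Types (Z : set 'rV[R]_n) (F : 'rV[R]_n -> R) (u v x z : 'rV[R]_n).

Definition dot u v : R := \sum_(i < n) u 0 i * v 0 i.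

(* The library norm [`|u|] on row vectors is the sup norm, hence a separate
   Euclidean norm.  Closedness, boundedness and differentiability, which do not
   depend on the choice between equivalent norms, are those of the library. *)
Definition enorm u : R := Num.sqrt (dot u u).

Definition grad F z : 'rV[R]_n := \row_(i < n) 'D_(delta_mx 0 i) F z.

Definition smooth (l : R) F : Prop :=
  (forall z, differentiable F z) /\
  (forall z1 z2, enorm (grad F z1 - grad F z2) <= l * enorm (z1 - z2)).

(* [get] returns an arbitrary vector when no nearest point exists; for [Z]
   nonempty, closed and convex there is exactly one. *)
Definition proj Z x : 'rV[R]_n :=
  get [set p | Z p /\ forall q, Z q -> enorm (x - p) <= enorm (x - q)].

(* The attained minimum of [f] on [Z], and 0 if it is not attained; a continuous
   [f] attains it when [Z] is nonempty, closed and bounded. *)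
Definition minimum Z (f : 'rV[R]_n -> R) : R :=
  xget 0 [set m | (f @` Z) m /\ lbound (f @` Z) m].

Definition stationary1 (l : R) Z F (eps : R) z : Prop :=
  enorm (proj Z (z - l^-1 *: grad F z) - z) <= eps / l.

Definition gap (l : R) Z F z : R :=
  - 2 * l *
  minimum Z (fun x => dot (grad F z) (x - z) + l / 2 * enorm (x - z) ^+ 2).

Definition stationary2 (l : R) Z F (eps : R) z : Prop :=
  gap l Z F z <= eps ^+ 2.

Definition problem (l : R) Z F : Prop :=
  [/\ 0 < l, Z !=set0, closed Z, bounded_set Z & convex_set Z] /\ smooth l F.

End Stationarity.

(* Main.v *)
(** Up to an additive constant, the model minimised in the definition of
    [D(z)] is [l/2] times the squared distance to [z - l^-1 grad F(z)], so its
    minimiser over [Z] is the projection [p] used by the first notion.  The model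
    vanishes at [z] and is [l]-strongly convex, so its minimum is at most
    [- l/2 * |p - z|^2], that is [D(z) >= l^2 |p - z|^2], which gives (a).  For (b)
    take [F(x) = (1 + eps) x] on [[0, eps]] with [l = 1] and [z = eps]: the
    projection moves [z] by at most [eps], the length of [Z], while testing the
    minimum at [x = 0] gives [D(z) >= 2 eps + eps^2]. *)
Require Import Defs.
From HB Require Import structures.
From mathcomp Require Import all_boot all_order all_algebra.
From mathcomp Require Import all_classical all_reals all_analysis.
From mathcomp Require Import ring lra.

Set Implicit Arguments.
Unset Strict Implicit.
Unset Printing Implicit Defensive.

Import Order.TTheory GRing.Theory Num.Theory numFieldNormedType.Exports.
Local Open Scope classical_set_scope.
Local Open Scope ring_scope.

Section Model.
Context {R : realType} {n : nat}.
Implicit Types (Z : set 'rV[R]_n) (g p u x y z : 'rV[R]_n) (l t : R).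

Lemma dot_ge0 u : 0 <= dot u u.
Proof. by apply: sumr_ge0 => i _; rewrite -expr2 sqr_ge0. Qed.

Lemma dotr0 u : dot u 0 = 0.
Proof. by apply: big1 => i _; rewrite mxE mulr0. Qed.

Lemma enorm_ge0 u : 0 <= enorm u.
Proof. exact: sqrtr_ge0. Qed.

Lemma sqr_enorm u : enorm u ^+ 2 = dot u u.
Proof. by rewrite sqr_sqrtr// dot_ge0. Qed.

Definition model l g z x : R := dot g (x - z) + l / 2 * enorm (x - z) ^+ 2.

Lemma model_refl l g z : model l g z z = 0.
Proof.
by rewrite /model sqr_enorm subrr !dotr0 mulr0 addr0.
Qed.

(** The model is quadratic with Hessian [l] times the identity, so its deviation from convex
    interpolation is known exactly, not merely bounded. *)
Lemma model_conv l g z p y t :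
  model l g z (t *: y + (1 - t) *: p) =
  t * model l g z y + (1 - t) * model l g z p
  - l / 2 * (t * (1 - t)) * enorm (y - p) ^+ 2.
Proof.
rewrite /model !sqr_enorm /dot !mulr_sumr -!big_split /= !mulr_sumr.
rewrite -!big_split /= -sumrB.
by apply: eq_bigr => i _; rewrite !mxE; field.
Qed.

(** Completing the square. The last term is independent of [x], so for positive [l] distances to the
    gradient step and values of the model rank points alike. *)
Lemma sqr_dist_gradient_step l g z x : l != 0 ->
  enorm (z - l^-1 *: g - x) ^+ 2 =
  2 / l * model l g z x + enorm g ^+ 2 / l ^+ 2.
Proof.
move=> l0; rewrite /model !sqr_enorm /dot mulr_sumr -big_split /= mulr_sumr.
rewrite mulr_suml -big_split /=.
by apply: eq_bigr => i _; rewrite !mxE; field.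
Qed.

Lemma le_dist_gradient_step l g z x y : 0 < l ->
  (enorm (z - l^-1 *: g - x) <= enorm (z - l^-1 *: g - y)) =
  (model l g z x <= model l g z y).
Proof.
move=> l0; rewrite -[LHS](ler_pXn2r (n := 2)) ?nnegrE ?enorm_ge0//.
rewrite !sqr_dist_gradient_step ?gt_eqF// lerD2r ler_pM2l//.
by rewrite divr_gt0.
Qed.

(* Compare [p] with the point of parameter [t] on the segment from [p] to [y];
   the factor [1 - t] disappears as [t] tends to 0. *)
Lemma model_growth l g z Z p y : convex_set Z -> Z p -> Z y ->
  (forall x, Z x -> model l g z p <= model l g z x) ->
  model l g z p + l / 2 * enorm (y - p) ^+ 2 <= model l g z y.
Proof.
move=> Zc Zp Zy pmin.
set d := enorm _ ^+ 2; set a := model l g z p; set b := model l g z y.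
have key t : 0 < t -> t < 1 -> a + l / 2 * (1 - t) * d <= b.
  move=> t0 t1.
  have Zt : Z (t *: y + (1 - t) *: p).
    have := Zc y p (Itv01 (ltW t0) (ltW t1)) (mem_set Zy) (mem_set Zp).
    by move/set_mem.
  have := pmin _ Zt; rewrite model_conv -/a -/b -/d => H.
  have : t * (a + l / 2 * (1 - t) * d) <= t * b by lra.
  by rewrite ler_pM2l.
apply/ler_addgt0Pr => e e0.
(* The summand 1 keeps [k] positive even if [d = 0]; the choice of [t] then makes the lost term
   [t * (l / 2 * d)] at most [e], with [t < 1]. *)
pose k := `|l / 2 * d| + 1.
have k0 : 0 < k by rewrite ltr_wpDl.
pose t := Num.min (e / k) (1 / 2).
have t0 : 0 < t by rewrite lt_min !divr_gt0.
have t1 : t < 1 by rewrite gt_min; apply/orP; right; lra.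
have tk : t * k <= e by rewrite -ler_pdivlMr// ge_min lexx.
have : t * (l / 2 * d) <= t * k.
  by rewrite ler_pM2l// (le_trans (ler_norm _))// lerDl.
have := key t t0 t1; lra.
Qed.

Lemma model_continuous l g z : continuous (model l g z).
Proof.
move=> x; rewrite /model.
(* As a sum of polynomials in the coordinates, the model no longer involves the square root, which
   is not differentiable at 0. *)
have -> : (fun x => dot g (x - z) + l / 2 * enorm (x - z) ^+ 2) =
    \sum_(i < n) (fun x : 'rV[R]_n =>
      g 0 i * (x 0 i - z 0 i) + l / 2 * ((x 0 i - z 0 i) * (x 0 i - z 0 i))).
  apply/funext => y; rewrite fct_sumE sqr_enorm /dot mulr_sumr -big_split /=.
  by apply: eq_bigr => i _; rewrite !mxE.
apply: differentiable_continuous; apply: differentiable_sum => i.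
have dc : differentiable (fun x : 'rV[R]_n => x 0 i - z 0 i) x.
  by apply: differentiableB => //; exact: differentiable_coord.
by apply: differentiableD; apply: differentiableM => //; exact: differentiableM.
Qed.

Lemma minimumE Z (f : 'rV[R]_n -> R) p :
  Z p -> (forall x, Z x -> f p <= f x) -> minimum Z f = f p.
Proof.
move=> Zp pmin; rewrite /minimum; case: xgetP => [m -> [[q Zq <-] lb]|/(_ (f p))].
  by apply/eqP; rewrite eq_le pmin// lb//; exists p.
by case; split; [exists p|move=> _ [q Zq <-]; exact: pmin].
Qed.

(* [proj] alone denotes a projection of MathComp-Analysis here. *)
Lemma proj_model l g z Z : 0 < l -> Z !=set0 -> closed Z -> bounded_set Z ->
  let p := Defs.proj Z (z - l^-1 *: g) in
  Z p /\ (forall x, Z x -> model l g z p <= model l g z x).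
Proof.
move=> l0 Z0 Zcl Zb /=.
have [c cZ cmin] := EVT_min_rV Z0 (bounded_closed_compact Zb Zcl)
  (continuous_subspaceT (@model_continuous l g z)).
(* The [get] inside the projection is meaningful only once a nearest point exists; the minimiser [c]
   of the model is one. *)
have ex : exists p, Z p /\
    forall q, Z q -> enorm (z - l^-1 *: g - p) <= enorm (z - l^-1 *: g - q).
  exists c; split; first exact: set_mem.
  by move=> q /mem_set /cmin; rewrite le_dist_gradient_step.
have [Zp pmin] := getPex ex.
by split=> // x Zx; rewrite -le_dist_gradient_step//; exact: pmin.
Qed.

Lemma gap_ge l Z (F : 'rV[R]_n -> R) z x : problem l Z F -> Z x ->
  - 2 * l * model l (grad F z) z x <= gap l Z F z.
Proof.
move=> [[l0 Z0 Zcl Zb _] _] Zx.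
have [Zp pmin] := proj_model (grad F z) z l0 Z0 Zcl Zb.
rewrite /gap (minimumE Zp pmin) ler_wnM2l ?pmin//.
by rewrite mulNr oppr_le0 mulr_ge0// ltW.
Qed.

(** Quadratic growth around the projection, applied at the feasible point [z], where the model
    vanishes; (a) follows by taking square roots. *)
Lemma gap_ge_sqr_proj l Z (F : 'rV[R]_n -> R) z : problem l Z F -> Z z ->
  (l * enorm (Defs.proj Z (z - l^-1 *: grad F z) - z)) ^+ 2 <= gap l Z F z.
Proof.
move=> [[l0 Z0 Zcl Zb Zc] _] Zz.
have [Zp pmin] := proj_model (grad F z) z l0 Z0 Zcl Zb.
have := model_growth Zc Zp Zz pmin.
rewrite /gap (minimumE Zp pmin) -/(model _ _ _ _) model_refl.
set p := Defs.proj _ _; set a := model _ _ _ _.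
have -> : enorm (z - p) ^+ 2 = enorm (p - z) ^+ 2.
  by rewrite !sqr_enorm; apply: eq_bigr => i _; rewrite !mxE; ring.
move: (enorm _) => d H.
have : l * (a + l / 2 * d ^+ 2) <= 0 by rewrite pmulr_rle0.
lra.
Qed.

End Model.

Section Segment.
Context {R : realType}.
Implicit Types (a b c : R).

Definition segment b : set 'rV[R]_1 := [set x | 0 <= x 0 0 <= b].

Lemma grad_coord c z : grad (fun x : 'rV[R]_1 => c * x 0 0) z = const_mx c.
Proof.
apply/rowP => i; rewrite !mxE; apply: cvg_lim => //.
(* By linearity the difference quotient equals [c] for every nonzero [h]. *)
apply: cvg_near_cst; near=> h.
have h0 : h != 0 by near: h; exact: nbhs_dnbhs_neq.
rewrite /= !mxE !ord1 eqxx /= -[_ *: _]/(_ * _).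
by field.
Unshelve. all: by end_near. Qed.

Lemma problem_segment b c : 0 <= b ->
  problem 1 (segment b) (fun x : 'rV[R]_1 => c * x 0 0).
Proof.
move=> b0; split; split => //.
- by exists 0; rewrite /segment /= mxE lexx.
- have -> : segment b = (fun x : 'rV[R]_1 => x 0 0) @^-1` `[0, b].
    by apply/seteqP; split => x; rewrite /segment /= in_itv.
  apply: preimage_closed; last exact: itv_closed.
  by move=> x _; exact: coord_continuous.
- exists b; split; first exact: num_real.
  move=> M bM x /andP[x0 xb].
  rewrite /Num.norm /= mx_normrE; apply: bigmax_le => [|[i j] _ /=].
    by rewrite (le_trans b0)// ltW.
  by rewrite !ord1 ger0_norm// (le_trans xb)// ltW.
- move=> x y t /set_mem/andP[x0 xb] /set_mem/andP[y0 yb].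
  apply: mem_set; rewrite /segment /conv /= !mxE.
  have [t0 t1] : 0 <= t%:num /\ t%:num <= 1 by [].
  rewrite /unstable.onem.
  move: (t%:num) t0 t1 (x 0 0) x0 xb (y 0 0) y0 yb => s s0 s1 u u0 ub v v0 vb.
  apply/andP; split; nra.
- move=> z; apply: differentiableM => //; exact: differentiable_coord.
- by move=> z1 z2; rewrite !grad_coord subrr mul1r {1}/enorm dotr0 sqrtr0 enorm_ge0.
Qed.

End Segment.

Theorem theorem4 (R : realType) :
  (forall (n : nat) (l : R) (Z : set 'rV[R]_n) (F : 'rV[R]_n -> R)
      (eps : R) (z : 'rV[R]_n),
    problem l Z F -> 0 < eps -> Z z ->
    stationary2 l Z F eps z -> stationary1 l Z F eps z) /\
  (forall eps : R, 0 < eps ->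
    exists (n : nat) (l : R) (Z : set 'rV[R]_n) (F : 'rV[R]_n -> R)
      (z : 'rV[R]_n),
    [/\ problem l Z F, Z z, stationary1 l Z F eps z &
      forall eps' : R, 0 <= eps' -> eps' < Num.sqrt (2 * eps + eps ^+ 2) ->
        ~ stationary2 l Z F eps' z]).
Proof.
split=> [n l Z F eps z P eps0 Zz S2|eps eps0].
  have [[l0 _ _ _ _] _] := P.
  rewrite /stationary1 ler_pdivlMr// mulrC.
  rewrite -(ler_pXn2r (n := 2)) ?nnegrE ?mulr_ge0 ?enorm_ge0//; last 2 first.
  - exact: ltW.
  - exact: ltW.
  exact: le_trans (gap_ge_sqr_proj P Zz) S2.
(* For slope [c], testing the gap at [0] gives [2 * c * eps - eps ^+ 2]; the slope [1 + eps] turns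
   this into [2 * eps + eps ^+ 2]. *)
pose F (x : 'rV[R]_1) := (1 + eps) * x 0 0.
have P : problem 1 (segment eps) F by apply/problem_segment/ltW.
pose z : 'rV[R]_1 := const_mx eps.
have Zz : segment eps z by rewrite /segment /= mxE lexx ltW.
exists 1%N, 1, (segment eps), F, z; split => //.
  have [[l0 Z0 Zcl Zb _] _] := P.
  have [] := proj_model (grad F z) z l0 Z0 Zcl Zb.
  (* Membership of the projection in the segment suffices; its minimality is dropped. *)
  rewrite /stationary1; move: (Defs.proj _ _) => p /andP[p0 pe] _.
  rewrite divr1 -[leRHS](ger0_norm (ltW eps0)) -sqrtr_sqr ler_wsqrtr//.
  rewrite /dot big_ord1 !mxE; nra.
move=> e e0 eS S2.
have Z0 : segment eps 0 by rewrite /segment /= mxE lexx ltW.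
have := le_trans (gap_ge z P Z0) S2.
rewrite /model sqr_enorm /dot grad_coord !big_ord1 !mxE => H.
have : e ^+ 2 < 2 * eps + eps ^+ 2.
  rewrite -[ltRHS]sqr_sqrtr; last by nra.
  by rewrite ltr_pXn2r// nnegrE// sqrtr_ge0.
lra.
Qed.
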